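(* Let $0\le\alpha<1$ and let $G$ be a simple connected graph of order $n\ge2$. Then $G$ has exactly two distinct $A_\alpha$-eigenvalues if and only if $G$ is isomorphic to the complete graph $K_n$.
   Context: For a finite simple graph $G$ with adjacency matrix $A(G)$ and diagonal degree matrix $D(G)$, and $0\le\alpha\le1$, $A_\alpha(G)=\alpha D(G)+(1-\alpha)A(G)$; its eigenvalues are the $A_\alpha$-eigenvalues of $G$. *)

(* Defs.v *)
From HB Require Import structures.
From mathcomp Require Import all_boot all_order all_algebra.
From mathcomp Require Import reals.

Set Implicit Arguments.
Unset Strict Implicit.
Unset Printing Implicit Defensive.

Import Order.TTheory GRing.Theory Num.Theory.
Local Open Scope ring_scope.

Record sgraph := SGraph {
  vertex :> finType;
  adj : rel vertex;
  adj_sym : symmetric adj;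
  adj_irrefl : irreflexive adj }.

Arguments adj {s} _ _.

(* Nonemptiness is not part of the definition. *)
Definition graph_connected (G : sgraph) : Prop :=
  forall x y : G, connect adj x y.

Definition graph_iso (G H : sgraph) : Prop :=
  exists f : G -> H, bijective f /\ forall x y : G, adj (f x) (f y) = adj x y.

Lemma neq_sym_rel (T : eqType) : symmetric (fun x y : T => x != y).
Proof. by move=> x y; rewrite eq_sym. Qed.

Lemma neq_irrefl_rel (T : eqType) : irreflexive (fun x y : T => x != y).
Proof. by move=> x; rewrite eqxx. Qed.

Definition complete_graph (n : nat) : sgraph :=
  SGraph (@neq_sym_rel 'I_n) (@neq_irrefl_rel 'I_n).

Definition degree (G : sgraph) (x : G) : nat := #|[set y : G | adj x y]|.

(* Rows and columns follow the canonical enumeration of the vertices. *)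
Definition adj_mx (R : realType) (G : sgraph) : 'M[R]_#|G| :=
  \matrix_(i, j) (adj (enum_val i) (enum_val j))%:R.

Definition degree_mx (R : realType) (G : sgraph) : 'M[R]_#|G| :=
  diag_mx (\row_i (degree (enum_val i))%:R).

Definition A_alpha (R : realType) (alpha : R) (G : sgraph) : 'M[R]_#|G| :=
  alpha *: degree_mx R G + (1 - alpha) *: adj_mx R G.

(* [A_alpha alpha G] is real symmetric, so its eigenvalues are all real, and
   the row-vector convention of [eigenvalue] is immaterial. *)
Definition A_alpha_eigenvalue (R : realType) (alpha : R) (G : sgraph) (a : R)
  : bool := eigenvalue (A_alpha alpha G) a.

Definition exactly_two (T : Type) (P : T -> Prop) : Prop :=
  exists a b : T, a <> b /\ forall c : T, P c <-> c = a \/ c = b.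

(* Main.v *)
Require Import Defs.
From mathcomp Require Import all_boot all_order all_algebra.
From mathcomp Require Import reals complex ring.

Import Order.TTheory GRing.Theory Num.Theory.
Local Open Scope ring_scope.

(* If [M := A_alpha alpha G] has only the eigenvalues [a] and [b], then, being
   symmetric, it satisfies [(M - a) (M - b) = 0].  For distinct nonadjacent
   vertices [x] and [z] this gives [(M ^ 2) x z = 0]; as [M] has nonnegative
   entries, positive on the edges, [x] and [z] have no common neighbour.  So
   adjacency is transitive on distinct vertices, and a connected [G] is complete.
   Conversely, for a complete graph of order [n], [M] is
   [(alpha n - 1) I + (1 - alpha) J], with [J] the all-ones matrix. *)

(** Over [R[i]] the matrix becomes Hermitian, hence unitarily diagonalizable. Each diagonal entry is
    killed by one of the two factors, and injectivity of [map_mx f] brings the identity back to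
    [R]. *)
Lemma symmetric_mx_annihilated (R : rcfType) (n : nat) (M : 'M[R]_n) (a b : R) :
  M^T = M -> (forall c, eigenvalue M c -> c = a \/ c = b) ->
  (M - a%:M) *m (M - b%:M) = 0.
Proof.
move=> symM eigM; pose f : {rmorphism R -> R[i]} := real_complex R.
pose A := map_mx f M.
have hermA : A \is hermsymmx.
  apply: realsym_hermsym.
    by apply/is_hermitianmxP; rewrite expr0 scale1r map_mx_id // /A map_trmx symM.
  by apply/mxOverP => i j; rewrite mxE; apply/complex_realP; exists (M i j).
have /orthomx_spectralP := hermitian_normalmx hermA.
set P := spectralmx A; set d := spectral_diag A => defA.
have uP : P \in unitmx by apply: spectral_unit.
have PA : P *m A = diag_mx d *m P by rewrite {1}defA !mulmxA mulmxV // mul1mx.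
have d_ab i : d 0 i = f a \/ d 0 i = f b.
  (* The entry is real, equal to [f k], and row [i] of the invertible [P] is an eigenvector for it.
     Comparing characteristic polynomials makes [k] an eigenvalue of [M]. *)
  have /mxOverP/(_ 0 i)/complex_realP[k dk] := hermitian_spectral_diag_real hermA.
  have : eigenvalue A (d 0 i).
    apply/eigenvalueP; exists (row i P).
      by rewrite -row_mul PA row_mul row_diag_mx -scalemxAl -rowE.
    apply: contraTneq uP => Pi0; rewrite -row_free_unit.
    by apply/row_freePn; exists i; rewrite Pi0 sub0mx.
  rewrite -/d dk eigenvalue_root_char -map_char_poly fmorph_root.
  rewrite -eigenvalue_root_char.
  by move/eigM=> [] ->; [left|right].
have conjB c : P *m (A - (f c)%:M) = (diag_mx d - (f c)%:M) *m P.
  by rewrite mulmxBr PA mulmxBl scalar_mxC.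
apply: (map_mx_inj (f := f)); rewrite map_mxM !map_mxB !map_scalar_mx map_mx0 -/A.
rewrite -[LHS](mulKmx uP) (mulmxA P) conjB -mulmxA conjB (mulmxA (_ - _)).
suff -> : (diag_mx d - (f a)%:M) *m (diag_mx d - (f b)%:M) = 0
  by rewrite mul0mx mulmx0.
rewrite -!diag_const_mx -!raddfB /= mulmx_diag; apply/matrixP => i j; rewrite !mxE.
by case: (d_ab i) => ->; rewrite subrr ?mul0r ?mulr0 mul0rn.
Qed.

Lemma A_alphaE (R : realType) (alpha : R) (G : sgraph) (i j : 'I_#|G|) :
  A_alpha alpha G i j = alpha * (degree (enum_val i))%:R *+ (i == j) +
    (1 - alpha) * (adj (enum_val i) (enum_val j))%:R.
Proof. by rewrite !mxE -[in RHS]mulrnAr. Qed.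

Lemma A_alpha_sym (R : realType) (alpha : R) (G : sgraph) :
  (A_alpha alpha G)^T = A_alpha alpha G.
Proof.
apply/matrixP => i j; rewrite mxE !A_alphaE adj_sym eq_sym.
by case: eqP => // ->.
Qed.

(** By induction on a path from [x] to [y], transitivity contracts it to a single edge. *)
Lemma connected_transitive_complete (G : sgraph) :
  graph_connected G ->
  (forall x y z : G, adj x y -> adj y z -> x != z -> adj x z) ->
  forall x y : G, adj x y = (x != y).
Proof.
move=> conn tr x y; have [->|xy] := eqVneq x y; first by rewrite adj_irrefl.
have /connectP[p] := conn x y; move: xy.
elim: p x => [|z p IHp] x xy /= => [_ /eqP|/andP[xz pz] yl].
  by rewrite eq_sym (negbTE xy).
by have [<-//|zy] := eqVneq z y; apply: (tr x z) => //; apply: IHp.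
Qed.

Lemma graph_iso_complete (G : sgraph) (n : nat) : #|G| = n ->
  graph_iso G (complete_graph n) <-> forall x y : G, adj x y = (x != y).
Proof.
move=> <-; split=> [[f [bf adjf]] x y|adjG].
  by rewrite -adjf /= (inj_eq (bij_inj bf)).
exists enum_rank; split; first exact: enum_rank_bij.
by move=> x y; rewrite adjG /= (inj_eq enum_rank_inj).
Qed.

Lemma A_alpha_annihilated_transitive (R : realType) (alpha a b : R) (G : sgraph) :
  0 <= alpha < 1 ->
  (A_alpha alpha G - a%:M) *m (A_alpha alpha G - b%:M) = 0 ->
  forall x y z : G, adj x y -> adj y z -> x != z -> adj x z.
Proof.
move=> /andP[a0 a1] M0 x y z xy yz xz; apply: contraT => nxz.
set M := A_alpha alpha G in M0; pose i := enum_rank x; pose k := enum_rank z.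
have ik : i != k by rewrite (inj_eq enum_rank_inj).
have M_ge0 u v : 0 <= M u v.
  rewrite A_alphaE addr_ge0 // ?mulrn_wge0 ?mulr_ge0 ?ler0n //.
  by rewrite subr_ge0 ltW.
have Mik : M i k = 0.
  by rewrite A_alphaE !enum_rankK (negbTE ik) (negbTE nxz) mulr0 addr0.
have Madj u v : adj u v -> M (enum_rank u) (enum_rank v) != 0.
  move=> uv; rewrite A_alphaE !enum_rankK uv mulr1.
  rewrite (inj_eq enum_rank_inj); have [uv'|_] := eqVneq u v.
    by rewrite uv' adj_irrefl in uv.
  by rewrite add0r subr_eq0 gt_eqF.
(* At the off-diagonal position [(i, k)] the scalar term of the expanded product vanishes, and the
   linear terms vanish by [Mik]. *)
clearbody M; have : (M *m M) i k = 0.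
  move/matrixP/(_ i k): M0; rewrite mulmxBr !mulmxBl mul_mx_scalar !mul_scalar_mx.
  by rewrite !mxE Mik (negbTE ik) !mulr0 !subr0.
(* A vanishing sum of nonnegative terms has only zero terms, but the term at [y] is a product of two
   nonzero entries. *)
rewrite mxE => /eqP; rewrite psumr_eq0; last by move=> j _; apply: mulr_ge0.
move=> /allP/(_ (enum_rank y)); rewrite mem_index_enum => /(_ isT)/=.
by rewrite mulf_eq0 (negbTE (Madj _ _ xy)) (negbTE (Madj _ _ yz)).
Qed.

Lemma A_alpha_complete (R : realType) (alpha : R) (G : sgraph) :
  (forall x y : G, adj x y = (x != y)) ->
  A_alpha alpha G = (alpha * #|G|%:R - 1)%:M + const_mx (1 - alpha).
Proof.
move=> adjG; apply/matrixP => i j; rewrite A_alphaE !mxE adjG (inj_eq enum_val_inj).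
have [->|_] /= := eqVneq i j; last by rewrite !mulr0n mulr1.
(* With all degrees [#|G| - 1], the diagonal entry [alpha * (#|G| - 1)] splits as
   [(alpha * #|G| - 1) + (1 - alpha)]. *)
suff /(congr1 (fun m => m%:R : R)) : (degree (enum_val j)).+1 = #|G|.
  by rewrite -addn1 natrD /= => <-; rewrite !mulr1n; ring.
rewrite (cardD1 (enum_val j)) inE add1n; congr _.+1.
by apply: eq_card => y; rewrite !inE adjG eq_sym andbT.
Qed.

Lemma eigenvalue_scalar_const (F : fieldType) (n : nat) (s t c : F) :
  (2 <= n)%N ->
  t != 0 -> eigenvalue (s%:M + const_mx t : 'M[F]_n) c <->
  c = s + t * n%:R \/ c = s.
Proof.
move=> n2 t0.
have mulE (v : 'rV[F]_n) : v *m (s%:M + const_mx t) =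
    s *: v + const_mx (t * \sum_i v 0 i).
  apply/rowP => j; rewrite mulmxDr mul_mx_scalar !mxE; congr (_ + _).
  by rewrite mulrC mulr_suml; apply: eq_bigr => i _; rewrite mxE.
split=> [/eigenvalueP[v]|].
  rewrite mulE => vc v0; set S := \sum_i v 0 i in vc.
  have vcj j : s * v 0 j + t * S = c * v 0 j by move/rowP/(_ j): vc; rewrite !mxE.
  (* If the coordinate sum [S] is zero, a nonzero coordinate of [v] gives [c = s]. Otherwise,
     summing [vcj] over all coordinates and cancelling [S] gives the other value. *)
  have [S0|S0] := eqVneq S 0; [right|left].
    have /rV0Pn[j vj] := v0.
    by apply: (mulIf vj); rewrite -vcj S0 mulr0 addr0.
  apply: (mulIf S0); rewrite /S mulr_sumr -(eq_bigr _ (fun j _ => vcj j)) -/S.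
  by rewrite big_split /= -mulr_sumr -/S sumr_const card_ord -mulr_natr; ring.
(* The eigenvectors are the all-ones vector and, since there are at least two coordinates, a
   difference of two basis vectors, whose coordinate sum is zero. *)
case: n n2 mulE => [|[|n]] // _ mulE [->|->]; apply/eigenvalueP.
  exists (const_mx 1).
    rewrite mulE; apply/rowP => j; rewrite !mxE.
    rewrite (eq_bigr (fun=> 1)) => [|i _]; last by rewrite mxE.
    by rewrite sumr_const card_ord !mulr1.
  by apply/rV0Pn; exists 0; rewrite mxE oner_eq0.
exists (delta_mx 0 0 - delta_mx 0 1).
  rewrite mulE [X in const_mx X](_ : _ = 0).
    by rewrite [const_mx 0](_ : _ = 0) ?addr0 //; apply/rowP => j; rewrite !mxE.
  rewrite !big_ord_recl big1 => [|i _]; rewrite !mxE ?subrr //=; ring.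
by apply/rV0Pn; exists 0; rewrite !mxE /= subr0 oner_eq0.
Qed.

Theorem theorem3p4 (R : realType) (alpha : R) (n : nat) (G : sgraph)
  (halpha0 : 0 <= alpha) (halpha1 : alpha < 1)
  (hn : (2 <= n)%N) (hG : #|G| = n) (hconn : graph_connected G) :
  exactly_two (fun a : R => A_alpha_eigenvalue alpha G a) <->
  graph_iso G (complete_graph n).
Proof.
split=> [[a [b [_ eig_ab]]]|].
  apply/(graph_iso_complete _ _ hG); apply: connected_transitive_complete => //.
  apply: (@A_alpha_annihilated_transitive R alpha a b); first exact/andP.
  by apply: symmetric_mx_annihilated (A_alpha_sym _ _ _) _ => c /eig_ab.
move=> /(graph_iso_complete _ _ hG) adjG.
have t0 : 1 - alpha != 0 by rewrite subr_eq0 gt_eqF.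
exists (alpha * #|G|%:R - 1 + (1 - alpha) * #|G|%:R), (alpha * #|G|%:R - 1).
split=> [/eqP|c].
  (* The two values differ by [(1 - alpha) * n], which is nonzero. *)
  rewrite -subr_eq0 addrAC subrr add0r mulf_eq0 (negbTE t0) pnatr_eq0 hG.
  by rewrite gtn_eqF // ltnW.
rewrite /A_alpha_eigenvalue A_alpha_complete //.
by apply: eigenvalue_scalar_const; rewrite ?hG.
Qed.
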